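(* Let $M\ge 1$ and let $f,g:[0,\infty)\to[0,\infty)$ be piecewise-linear homeomorphisms with bounded slopes such that $H[f],H[g]\in H_{[1,M]}/H$. Suppose there exists a strictly increasing sequence $\{a_n\}$ of positive real numbers with $a_n\to\infty$ such that $\frac{f(a_n)}{a_n}\to 1$ and $\frac{g(a_n)}{a_n}\to 1$. For each $n$ let $a_n=x_{n,0}<x_{n,1}<\dots<x_{n,r}=a_{n+1}$ (with $r=r(n)$) be a partition of $[a_n,a_{n+1}]$ such that $f$ and $g$ are both linear (affine) on each interval $[x_{n,i-1},x_{n,i}]$, let $\lambda_{n,i}$ and $\lambda'_{n,i}$ be the slopes of $f$ and $g$ respectively on $[x_{n,i-1},x_{n,i}]$, and put $A_n=(\lambda_{n,1},\dots,\lambda_{n,r})$, $B_n=(\lambda'_{n,1},\dots,\lambda'_{n,r})$ and $\|A_n-B_n\|_\infty=\max_{1\le i\le r}|\lambda_{n,i}-\lambda'_{n,i}|$. Then: (a) if $\|A_n-B_n\|_\infty\to 0$ as $n\to\infty$, then $H[f]=H[g]$; (b) if there exists $K_1>1$ such that $x_{n,i}>K_1x_{n,i-1}$ for all $n$ and all $1\le i\le r(n)$, and $H[f]=H[g]$, then $\|A_n-B_n\|_\infty\to 0$ as $n\to\infty$.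
   Context: $\mathbb{R}_+=[0,\infty)$. $QI(\mathbb{R}_+)$ is the group (under composition) of quasi-isometries $\mathbb{R}_+\to\mathbb{R}_+$ modulo the relation of being at bounded distance; $[g]$ denotes the class of $g$. Every class is represented by a piecewise-linear homeomorphism of $[0,\infty)$ with bounded slopes, meaning that the set of break points is discrete and all slopes lie in $(C^{-1},C)$ for some $C>1$. For $[g]\in QI(\mathbb{R}_+)$ set $$S_{[g]}=\Big\{\lim_{n\to\infty}\tfrac{g(x_n)}{x_n} : x_n\to\infty \text{ and } \tfrac{g(x_n)}{x_n}\text{ converges}\Big\}.$$ $H_{[1,M]}=\{[g]\in QI(\mathbb{R}_+): S_{[g]}=[1,M]\}$ (where $[1,1]=\{1\}$). $H=\{[g]\in QI(\mathbb{R}_+):\lim_{x\to\infty}g(x)/x=1\}$, a normal subgroup of $QI(\mathbb{R}_+)$. $H$ acts on $H_{[1,M]}$ by left multiplication; $H_{[1,M]}/H$ is the set of orbits and $H[g]$ is the orbit (right coset) of $[g]$. *)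

(* Defs.v *)
From HB Require Import structures.
From mathcomp Require Import all_boot all_order all_algebra.
From mathcomp Require Import generic_quotient.
From mathcomp Require Import all_classical all_reals all_analysis.
From mathcomp Require Import ring lra.

Set Implicit Arguments.
Unset Strict Implicit.
Unset Printing Implicit Defensive.

Import Order.TTheory GRing.Theory Num.Theory.
Import numFieldNormedType.Exports.

Local Open Scope classical_set_scope.
Local Open Scope ring_scope.
Local Open Scope quotient_scope.

(* Self-maps of [0, +oo) are represented by total functions R -> R that
   preserve nonnegativity; every notion below only looks at the values on
   [0, +oo). *)

Section QuasiIsometries.
Context {R : realType}.
Implicit Types f g h : R -> R.

Definition quasi_isometry f :=
  {homo f : x / 0 <= x} /\
  exists K C : R, [/\ 1 <= K, 0 <= C,
    forall x y : R, 0 <= x -> 0 <= y ->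
      K^-1 * `|x - y| - C <= `|f x - f y| <= K * `|x - y| + C &
    forall y : R, 0 <= y -> exists2 x, 0 <= x & `|f x - y| <= C].

Definition bounded_dist f g :=
  exists C : R, forall x : R, 0 <= x -> `|f x - g x| <= C.

Lemma bounded_dist_refl f : bounded_dist f f.
Proof. by exists 0 => x _; rewrite subrr normr0. Qed.

Lemma bounded_dist_sym f g : bounded_dist f g -> bounded_dist g f.
Proof. by move=> [C fg]; exists C => x x0; rewrite distrC fg. Qed.

Lemma bounded_dist_trans g f h :
  bounded_dist f g -> bounded_dist g h -> bounded_dist f h.
Proof.
move=> [C fg] [D gh]; exists (C + D) => x x0.
by rewrite (le_trans (ler_distD (g x) _ _))// lerD ?fg ?gh.
Qed.

Lemma quasi_isometry_id : quasi_isometry (@idfun R).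
Proof.
split=> //; exists 1, 0; split=> // [x y _ _|y y0]; last first.
  by exists y => //=; rewrite subrr normr0.
by rewrite invr1 !mul1r subr0 addr0 lexx.
Qed.

Lemma quasi_isometry_comp f g :
  quasi_isometry f -> quasi_isometry g -> quasi_isometry (f \o g).
Proof.
move=> [f0 [K [C [K1 C0 fKC fC]]]] [g0 [L [D [L1 D0 gLD gD]]]].
have K0 : 0 < K by lra.
have L0 : 0 < L by lra.
split=> [x x0|]; first exact/f0/g0.
exists (K * L), (K * D + 2 * C); split=> [||x y x0 y0|z z0].
- by rewrite (le_trans K1)// ler_peMr// ltW.
- by rewrite addr_ge0 ?mulr_ge0// ltW.
- have /andP[gl gu] := gLD _ _ x0 y0.
  have /andP[fl fu] := fKC _ _ (g0 _ x0) (g0 _ y0).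
  apply/andP; split.
    have : K^-1 * (L^-1 * `|x - y| - D) <= K^-1 * `|g x - g y|.
      by rewrite ler_wpM2l// invr_ge0 ltW.
    have : K^-1 * D <= K * D.
      by rewrite ler_wpM2r// (le_trans _ K1)// invf_le1.
    rewrite invfM /=; lra.
  have : K * `|g x - g y| <= K * (L * `|x - y| + D) by rewrite ler_wpM2l// ltW.
  rewrite /=; lra.
- have [y y0 fyz] := fC _ z0; have [x x0 gxy] := gD _ y0.
  exists x => //=.
  have /andP[_ fu] := fKC _ _ (g0 _ x0) y0.
  have := ler_distD (f y) (f (g x)) z.
  have : K * `|g x - y| <= K * D by rewrite ler_wpM2l// ltW.
  lra.
Qed.

Lemma bounded_dist_comp f f' g g' : quasi_isometry f ->
    {homo g : x / 0 <= x} -> {homo g' : x / 0 <= x} ->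
  bounded_dist f f' -> bounded_dist g g' ->
  bounded_dist (f \o g) (f' \o g').
Proof.
move=> [f0 [K [C [K1 C0 fKC _]]]] g0 g'0 [D ff'] [E gg'].
exists (K * E + C + D) => x x0 /=.
have /andP[_ fu] := fKC _ _ (g0 _ x0) (g'0 _ x0).
have : K * `|g x - g' x| <= K * E by rewrite ler_wpM2l ?gg'//; lra.
have := ff' _ (g'0 _ x0); have := ler_distD (f (g' x)) (f (g x)) (f' (g' x)).
lra.
Qed.

Lemma quasi_isometry_inv f : quasi_isometry f ->
  exists h, [/\ quasi_isometry h, bounded_dist (h \o f) idfun &
                bounded_dist (f \o h) idfun].
Proof.
move=> [f0 [K [C [K1 C0 fKC fC]]]].
have K0 : 0 < K by lra.
have /choice[h hP] : forall y, exists x,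
    0 <= y -> 0 <= x /\ `|f x - y| <= C.
  move=> y; have [/fC[x x0 fxy]|y0] := boolP (0 <= y).
    by exists x.
  by exists 0.
have h0 y : 0 <= y -> 0 <= h y by move/hP => [].
have fh y : 0 <= y -> `|f (h y) - y| <= C by move/hP => [].
have hf x : 0 <= x -> `|h (f x) - x| <= 2 * K * C.
  move=> x0; have /andP[fl _] := fKC _ _ (h0 _ (f0 _ x0)) x0.
  have {}fl : K^-1 * `|h (f x) - x| <= 2 * C by have := fh _ (f0 _ x0); lra.
  have -> : 2 * K * C = K * (2 * C) by ring.
  by rewrite -ler_pdivrMl.
exists h; split; [|by exists (2 * K * C)|by exists C].
split=> //; exists K, (3 * K * C).
have KC0 : 0 <= K * C by rewrite mulr_ge0// ltW.
split=> // [|x y x0 y0|y y0].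
- by rewrite -mulrA mulr_ge0.
- have /andP[fl fu] := fKC _ _ (h0 _ x0) (h0 _ y0).
  have fx := fh _ x0; have fy := fh _ y0.
  have u1 : `|f (h x) - f (h y)| <= `|x - y| + 2 * C.
    have -> : f (h x) - f (h y) = (f (h x) - x) + (x - y) - (f (h y) - y).
      by ring.
    have := ler_normB (f (h x) - x + (x - y)) (f (h y) - y).
    have := ler_normD (f (h x) - x) (x - y).
    lra.
  have u2 : `|x - y| <= `|f (h x) - f (h y)| + 2 * C.
    have -> : x - y = (f (h x) - f (h y)) - (f (h x) - x) + (f (h y) - y).
      by ring.
    have := ler_normD (f (h x) - f (h y) - (f (h x) - x)) (f (h y) - y).
    have := ler_normB (f (h x) - f (h y)) (f (h x) - x).
    lra.
  apply/andP; split.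
    have e : K^-1 * `|x - y| <= K^-1 * (K * `|h x - h y| + 3 * C).
      by rewrite ler_wpM2l ?invr_ge0 ?(ltW K0)//; lra.
    have : K^-1 * C <= K * C.
      by rewrite ler_wpM2r// (le_trans _ K1)// invf_le1.
    move: e; rewrite mulrDr mulKf ?gt_eqF//; lra.
  have : K * (K^-1 * `|h x - h y|) <= K * (`|x - y| + 3 * C).
    by rewrite ler_wpM2l ?(ltW K0)//; lra.
  rewrite mulVKf ?gt_eqF//; lra.
- exists (f y); first exact: f0.
  by rewrite (le_trans (hf _ y0))// -!mulrA; lra.
Qed.

End QuasiIsometries.

Section QIGroup.
Variable R : realType.

Record qi_map := QIMap {
  qi_fun :> R -> R;
  qi_funP : quasi_isometry qi_fun }.

HB.instance Definition _ := gen_eqMixin qi_map.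
HB.instance Definition _ := gen_choiceMixin qi_map.

Definition qi_rel (f g : qi_map) : bool := `[< bounded_dist f g >].

Lemma qi_rel_equiv : equiv_class_of qi_rel.
Proof.
split=> [f|f g|g f h].
- exact/asboolP/bounded_dist_refl.
- by apply/asboolP/asboolP; exact: bounded_dist_sym.
- by move=> /asboolP fg /asboolP gh; exact/asboolP/(bounded_dist_trans fg).
Qed.

Canonical qi_equiv := EquivRelPack qi_rel_equiv.

Definition QI : Type := {eq_quot qi_equiv}.
HB.instance Definition _ := Choice.on QI.

Definition qi_class (f : qi_map) : QI := \pi_({eq_quot qi_equiv}) f.

Definition qi_repr (c : QI) : qi_map := repr (c : {eq_quot qi_equiv}).

Lemma qi_reprK : cancel qi_repr qi_class.
Proof. exact: reprK. Qed.

Lemma qi_classP (f g : qi_map) :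
  qi_class f = qi_class g <-> bounded_dist f g.
Proof. by split=> [/eqmodP/asboolP|/asboolP fg]; last exact/eqmodP. Qed.

Lemma qi_repr_class (f : qi_map) : bounded_dist (qi_repr (qi_class f)) f.
Proof. by apply/qi_classP; exact: qi_reprK. Qed.

Definition qi_comp (f g : qi_map) : qi_map :=
  QIMap (quasi_isometry_comp (qi_funP f) (qi_funP g)).

Definition qi_one : QI := qi_class (QIMap quasi_isometry_id).

Definition qi_mul (a b : QI) : QI := qi_class (qi_comp (qi_repr a) (qi_repr b)).

Definition qi_inv (a : QI) : QI :=
  let: exist h hP := cid (quasi_isometry_inv (qi_funP (qi_repr a))) in
  qi_class (QIMap (let: And3 q _ _ := hP in q)).

Lemma qi_mul_class (f g : qi_map) :
  qi_mul (qi_class f) (qi_class g) = qi_class (qi_comp f g).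
Proof.
apply/qi_classP/bounded_dist_comp; [exact: qi_funP | | |
  exact: qi_repr_class | exact: qi_repr_class].
- by case: (qi_funP (qi_repr (qi_class g))).
- by case: (qi_funP g).
Qed.

Lemma qi_mulA : associative qi_mul.
Proof.
move=> a b c; rewrite -(qi_reprK a) -(qi_reprK b) -(qi_reprK c) !qi_mul_class.
by apply/qi_classP; exact: bounded_dist_refl.
Qed.

Lemma qi_mul1 : left_id qi_one qi_mul.
Proof.
move=> a; rewrite -(qi_reprK a) qi_mul_class.
by apply/qi_classP; exact: bounded_dist_refl.
Qed.

Lemma qi_mulr1 : right_id qi_one qi_mul.
Proof.
move=> a; rewrite -(qi_reprK a) qi_mul_class.
by apply/qi_classP; exact: bounded_dist_refl.
Qed.

Lemma qi_mulV : left_inverse qi_one qi_inv qi_mul.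
Proof.
move=> a; rewrite /qi_inv; case: cid => h [qh hf fh].
by rewrite -[X in qi_mul _ X]qi_reprK qi_mul_class; exact/qi_classP.
Qed.

Lemma qi_mulrV : right_inverse qi_one qi_inv qi_mul.
Proof.
move=> a; rewrite /qi_inv; case: cid => h [qh hf fh].
by rewrite -[X in qi_mul X _]qi_reprK qi_mul_class; exact/qi_classP.
Qed.

HB.instance Definition _ :=
  isGroup.Build QI qi_mulA qi_mul1 qi_mulr1 qi_mulV qi_mulrV.

Lemma qi_classM (f g : qi_map) :
  (qi_class f * qi_class g)%g = qi_class (qi_comp f g).
Proof. exact: qi_mul_class. Qed.

End QIGroup.

Section SlopeSets.
Variable R : realType.

Definition ratio_limits (f : R -> R) : set R :=
  [set l | exists x : nat -> R,
    [/\ forall n, 0 < x n, x n @[n --> \oo] --> +oo &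
        f (x n) / x n @[n --> \oo] --> l]].

Definition S_set (c : QI R) : set R := ratio_limits (qi_repr c).

Lemma ratio_limits_bounded_dist (f g : R -> R) :
  bounded_dist f g -> ratio_limits f `<=` ratio_limits g.
Proof.
move=> [C fg] l [x [x0 xoo fl]]; exists x; split=> //.
have xV : (x n)^-1 @[n --> \oo] --> (0 : R).
  by apply/gtr0_cvgV0 => //; near=> n; exact: x0.
have dfg : (f (x n) - g (x n)) / x n @[n --> \oo] --> (0 : R).
  apply: (@squeeze_cvgr _ _ _ _ (fun n => - (C * (x n)^-1))
                                 (fun n => C * (x n)^-1)).
  - near=> n; rewrite -ler_norml normrM normfV (gtr0_norm (x0 n)).
    by rewrite ler_wpM2r ?invr_ge0 ?fg// ltW.
  - by rewrite -oppr0; apply: cvgN; rewrite -(mulr0 C); exact: cvgMr.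
  - by rewrite -(mulr0 C); exact: cvgMr.
rewrite -(subr0 l).
have -> : (fun n => g (x n) / x n) =
    (fun n => f (x n) / x n - (f (x n) - g (x n)) / x n).
  by apply/funext => n; rewrite -mulrBl subKr.
exact: cvgB.
Unshelve. all: by end_near. Qed.

Lemma S_set_class (f : qi_map R) : S_set (qi_class f) = ratio_limits f.
Proof.
have ff := qi_repr_class f.
apply/seteqP; split; first exact: ratio_limits_bounded_dist.
exact/ratio_limits_bounded_dist/bounded_dist_sym.
Qed.

Definition QI_H : set (QI R) :=
  [set qi_class f | f in [set f : qi_map R | f x / x @[x --> +oo] --> (1 : R)]].

Definition H_itv (M : R) : set (QI R) := [set c | S_set c = `[1, M]%classic].

Definition H_orbit (c : QI R) : set (QI R) := [set (h * c)%g | h in QI_H].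

Definition H_itv_orbits (M : R) : set (set (QI R)) :=
  [set H_orbit c | c in H_itv M].

End SlopeSets.

Section PiecewiseLinear.
Context {R : realType}.
Implicit Types f : R -> R.

Definition homeo_nneg f :=
  [/\ {homo f : x / 0 <= x}, {within `[0, +oo[, continuous f} &
   exists h : R -> R,
    [/\ {homo h : x / 0 <= x}, {within `[0, +oo[, continuous h},
        {in `[0, +oo[, cancel f h} & {in `[0, +oo[, cancel h f}]].

Definition affine_on f (u v l : R) :=
  forall x : R, u <= x <= v -> f x = f u + l * (x - u).

(* At 0 the neighborhood is one-sided. This set is closed in [0, +oo), so its
   being discrete means that it is locally finite. *)
Definition break_points f : set R :=
  [set x : R | 0 <= x /\
    ~ exists l : R, \forall y \near within `[0, +oo[ (nbhs x),
        f y = f x + l * (y - x)].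

Definition piecewise_linear f :=
  forall x, break_points f x -> \forall y \near x^', ~ break_points f y.

Definition bounded_slopes f :=
  exists2 C : R, 1 < C & forall u v l : R, 0 <= u -> u < v ->
    affine_on f u v l -> C^-1 < l < C.

Record pl_homeo f : Prop := PLHomeo {
  pl_homeo_homeo : homeo_nneg f;
  pl_homeo_pl : piecewise_linear f;
  pl_homeo_slopes : bounded_slopes f }.

Lemma local_to_global (P : R -> R -> Prop) (a b : R) : a <= b ->
    (forall x, P x x) -> (forall x y z, P x y -> P y z -> P x z) ->
    (forall s, a <= s <= b -> exists2 e, 0 < e & forall y z : R,
      a <= y -> s - e < y <= s -> s <= z < s + e -> P y z) ->
  P a b.
Proof.
move=> ab Pxx Ptr Ploc; pose T := [set t | a <= t <= b /\ P a t].
have Ta : T a by split=> //; rewrite lexx.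
have Tub : ubound T b by move=> t [/andP[]].
have hs : has_sup T by split; [exists a|exists b].
have as_ : a <= sup T by apply: ub_le_sup => //; exists b.
have sb : sup T <= b by apply: ge_sup => //; exists a.
have [e e0 Pe] := Ploc (sup T) ltac:(by rewrite as_ sb).
have [t [/andP[at_ tb] Pat] st] := sup_adherent e0 hs.
have ts : t <= sup T by apply: ub_le_sup; [exists b|split=> //; exact/andP].
pose z := Num.min b (sup T + e / 2).
have sz : sup T <= z by rewrite le_min sb /=; lra.
have ze : z < sup T + e by rewrite gt_min; apply/orP; right; lra.
have Paz : P a z by apply: Ptr Pat _; apply: Pe; rewrite ?st ?sz.
have [bs|bs] := leP b (sup T + e / 2).
  by move: Paz; rewrite /z (min_idPl bs).
have : T z by split=> //; rewrite (le_trans as_ sz)/= ge_min lexx.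
move=> /(ub_le_sup (ex_intro _ b Tub)).
by rewrite /z (min_idPr (ltW bs)); lra.
Qed.

Lemma pl_homeo_slopeP f : pl_homeo f -> exists2 C : R, 1 < C &
  forall u v : R, 0 <= u -> u <= v -> (v - u) / C <= f v - f u <= C * (v - u).
Proof.
move=> [[f0 fc _] fpl [C C1 fsl]]; exists C => // a b a0 ab.
have C0 : 0 < C by lra.
have nb (x : R) : 0 <= x -> ~ break_points f x -> exists2 l, C^-1 < l < C &
    exists2 e, 0 < e & forall y : R, 0 <= y -> `|x - y| < e ->
      f y = f x + l * (y - x).
  move=> x0 xb; have [l] : exists l : R, \forall y \near within `[0, +oo[ (nbhs x),
      f y = f x + l * (y - x).
    by apply: contrapT => xl; exact: xb.
  rewrite near_withinE => /nbhs_ballP[e /= e0 fe].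
  have {}fe (y : R) : 0 <= y -> `|x - y| < e -> f y = f x + l * (y - x).
    by move=> y0 xy; apply: fe => //=; rewrite in_itv/= y0.
  exists l; last by exists e.
  apply: (fsl x (x + e / 2)); [by []|lra|] => y /andP[xy ye].
  apply: fe; first lra.
  by rewrite ler0_norm; lra.
have mvt (u v : R) : 0 <= u -> u <= v -> (forall x, u < x < v -> ~ break_points f x) ->
    (v - u) / C <= f v - f u <= C * (v - u).
  move=> u0 uv uvb.
  have df x : u < x < v -> exists2 l, C^-1 < l < C & is_derive x 1 f l.
    move=> /[dup] xuv /andP[ux xv]; have x0 : 0 < x by lra.
    have [l lC [e e0 fe]] := nb _ (ltW x0) (uvb _ xuv); exists l => //.
    apply: (@near_eq_is_derive _ _ _ (fun y => f x + l * (y - x))).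
      near=> y; rewrite (fe y)//.
      by apply: ltW; near: y; exact: (cvgr_gt _ (@cvg_id _ _)).
    apply: is_derive_eq; rewrite /GRing.scale /=; ring.
  move: uv; rewrite le_eqVlt => /predU1P[<-|uv].
    by rewrite !subrr mul0r mulr0 lexx.
  have [] := @MVT R f (fun x => 'D_1 f x) _ _ uv.
  - by move=> x; rewrite in_itv/= => /df[l _ fl]; rewrite derive_val.
  - apply: continuous_subspaceW fc => x /=; rewrite !in_itv/= => /andP[ux _].
    by rewrite andbT (le_trans u0).
  move=> c; rewrite in_itv/= => /df[l /andP[lC Cl] fl].
  rewrite derive_val => ->; rewrite mulrC !ler_wpM2r//; lra.
apply: (@local_to_global (fun u v => (v - u) / C <= f v - f u <= C * (v - u))
  _ _ ab).
- by move=> x; rewrite !subrr mul0r mulr0 lexx.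
- move=> x y z /andP[xy1 xy2] /andP[yz1 yz2]; apply/andP; split; last by lra.
  have -> : (z - x) / C = (z - y) / C + (y - x) / C by ring.
  lra.
move=> s /andP[as_ sb]; have s0 : 0 <= s by lra.
have [sbr|sbr] := pselect (break_points f s); last first.
  have [l /andP[lC Cl] [e e0 fe]] := nb _ s0 sbr.
  exists e => // y z ay /andP[sy ys] /andP[sz zs].
  rewrite (fe z); [|lra|by rewrite ler0_norm; lra].
  rewrite (fe y); [|lra|by rewrite ger0_norm; lra].
  have -> : f s + l * (z - s) - (f s + l * (y - s)) = l * (z - y) by ring.
  by rewrite mulrC !ler_wpM2r//; lra.
have /nbhs_ballP[e /= e0 fe] := fpl s sbr.
exists e => // y z ay /andP[sy ys] /andP[sz zs].
have /andP[xy1 xy2] : (s - y) / C <= f s - f y <= C * (s - y).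
  apply: mvt; [lra|by []|] => x /andP[yx xs]; apply: fe; last lra.
  by rewrite /ball/= ger0_norm; lra.
have /andP[yz1 yz2] : (z - s) / C <= f z - f s <= C * (z - s).
  apply: mvt; [lra|by []|] => x /andP[yx xs]; apply: fe; last lra.
  by rewrite /ball/= ler0_norm; lra.
apply/andP; split; last by lra.
have -> : (z - y) / C = (z - s) / C + (s - y) / C by ring.
lra.
Unshelve. all: by end_near. Qed.

Lemma pl_homeo_quasi_isometry f : pl_homeo f -> quasi_isometry f.
Proof.
move=> /[dup] -[[f0 _ [h [h0 _ _ hK]]] _ _] /pl_homeo_slopeP[C C1 fC].
split=> //; exists C, 0; split=> // [|x y x0 y0|y y0]; first exact: ltW.
- wlog xy : x y x0 y0 / x <= y.
    move=> wl; case: (leP x y) => [|/ltW]; first exact: wl.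
    by rewrite (distrC x) (distrC (f x)); exact: wl.
  have /andP[fl fu] := fC _ _ x0 xy.
  have yx0 : 0 <= (y - x) / C by rewrite divr_ge0//; lra.
  rewrite (distrC x) (distrC (f x)) subr0 addr0 !ger0_norm ?subr_ge0//.
    by rewrite mulrC fl fu.
  lra.
- by exists (h y); rewrite ?h0// hK ?subrr ?normr0// in_itv/= y0.
Qed.

End PiecewiseLinear.

Definition pl_class (R : realType) (f : R -> R) (hf : pl_homeo f) : QI R :=
  qi_class (QIMap (pl_homeo_quasi_isometry hf)).

(* Main.v *)
Require Import Defs.
From mathcomp Require Import all_boot all_order all_algebra.
From mathcomp Require Import all_classical all_reals all_analysis.
From mathcomp Require Import ring lra.

Set Implicit Arguments.
Unset Strict Implicit.
Unset Printing Implicit Defensive.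

Import Order.TTheory GRing.Theory Num.Theory.
Import numFieldNormedType.Exports.

Local Open Scope classical_set_scope.
Local Open Scope ring_scope.

(** Two maps have the same orbit under [H] exactly when their difference is
    sublinear: [f x - g x = o(x)] as [x] tends to infinity
    ([H_orbit_eqP]).  Indeed [[f] = [h][g]] with [h(y)/y] tending to 1 says
    [f x = g x + o(g x)] up to a bounded error, and a quasi-isometry grows at
    most linearly, so [o(g x)] is [o(x)].  Conversely, a sublinear difference
    survives precomposition with a quasi-inverse [q] of [g], so that [f o q] is
    asymptotic to [g o q], hence to the identity, and represents an element of
    [H] carrying [[g]] to [[f]].

    The theorem thus compares [f x - g x = o(x)] with the convergence of the
    slopes.  On each cell of the partition [f - g] is affine with slope
    [A_i - B_i].

    For (a), the slopes of [f - g] on the n-th block are at most [e] for large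
    [n], and [|f - g| <= e * a_n] at its left end, because [f(a_n)] and
    [g(a_n)] are both [a_n + o(a_n)].  The bound [|f x - g x| <= e * x] then
    propagates through the cells of the block ([affine_pieces_bound]); the
    blocks cover a neighbourhood of infinity.

    For (b), the slope of [f - g] on a cell [[u, v]] is its increment divided
    by [v - u], and the increment is at most [e * (u + v)].  Since
    [v > K1 * u], the ratio [(u + v) / (v - u)] is at most
    [(K1 + 1) / (K1 - 1)], so that the slope is [O(e)]
    ([slope_le_of_linear_bound]). *)

(** * Sublinear differences *)

Section SublinearDifference.
Context {R : realType}.
Implicit Types f g h q : R -> R.

(** For maps growing linearly this is the relation [f x / g x --> 1]; the
    multiplicative form with [e * x] avoids all divisions. *)
Definition sublinear_diff f g :=
  forall e : R, 0 < e -> \forall x \near +oo, `|f x - g x| <= e * x.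

Lemma sublinear_diff_sym f g : sublinear_diff f g -> sublinear_diff g f.
Proof.
by move=> fg e e0; apply: filterS (fg e e0) => x; rewrite distrC.
Qed.

Lemma sublinear_diff_trans g f h :
  sublinear_diff f g -> sublinear_diff g h -> sublinear_diff f h.
Proof.
move=> fg gh e e0; have e2 : 0 < e / 2 by rewrite divr_gt0.
apply: filterS2 (fg _ e2) (gh _ e2) => x fgx ghx.
by have := ler_distD (g x) (f x) (h x); lra.
Qed.

Lemma bounded_dist_sublinear f g : bounded_dist f g -> sublinear_diff f g.
Proof.
move=> [C fg] e e0; near=> x.
(* An [x] near infinity exceeds any constant chosen before it. *)
have x0 : 0 <= x by [].
by rewrite (le_trans (fg _ x0))// mulrC -ler_pdivrMr.
Unshelve. all: by end_near. Qed.

(** One statement for limits along the whole half-line ([u] the identity) and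
    along the sequence of block endpoints. *)
Lemma ratio_cvg1P (T : Type) (F : set_system T) (FF : Filter F)
    (f : R -> R) (u : T -> R) : (\forall t \near F, 0 < u t) ->
  f (u t) / u t @[t --> F] --> (1 : R) <->
  forall e : R, 0 < e -> \forall t \near F, `|f (u t) - u t| <= e * u t.
Proof.
move=> u0; rewrite cvgrPdist_le.
have E t (e : R) : 0 < u t ->
    (`|1 - f (u t) / u t| <= e) = (`|f (u t) - u t| <= e * u t).
  move=> ut0; rewrite -ler_pdivrMr// distrC.
  rewrite -[X in _ = (_ / X <= _)](gtr0_norm ut0) -normf_div mulrBl.
  rewrite divff ?gt_eqF//.
by split=> h e e0; apply: filterS2 u0 (h e e0) => t /E ->.
Qed.

Lemma ratio_cvg1_sublinear f :
  f x / x @[x --> +oo] --> (1 : R) <-> sublinear_diff f idfun.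
Proof.
by apply: (@ratio_cvg1P _ _ _ f id); exact: nbhs_pinfty_gt.
Qed.

Lemma quasi_isometry_cvgy q :
  quasi_isometry q -> q x @[x --> +oo] --> +oo.
Proof.
move=> [q0 [K [C [K1 C0 qKC _]]]]; have K0 : 0 < K by lra.
apply/cvgryPge => B; near=> x.
have x0 : 0 <= x by [].
have /andP[ql _] := qKC x 0 x0 (lexx _).
have q00 := q0 _ (lexx 0); have qx0 := q0 _ x0.
have qx : `|q x - q 0| <= q x + q 0.
  by rewrite (le_trans (ler_normB _ _))// !ger0_norm.
have : B + q 0 + C <= K^-1 * x.
  by rewrite mulrC ler_pdivlMr.
by move: ql; rewrite subr0 (ger0_norm x0); lra.
Unshelve. all: by end_near. Qed.

Lemma quasi_isometry_linear_bound q : quasi_isometry q ->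
  exists2 L : R, 0 < L & \forall x \near +oo, q x <= L * x.
Proof.
move=> [q0 [K [C [K1 C0 qKC _]]]]; exists (K + 1); first lra.
near=> x.
have x0 : 0 <= x by [].
have /andP[_ qu] := qKC x 0 x0 (lexx _).
have : q 0 + C <= x by [].
have := ler_norm (q x - q 0).
by move: qu; rewrite subr0 (ger0_norm x0); lra.
Unshelve. all: by end_near. Qed.

(** At [q x], which tends to infinity, an error [e / L * q x] is at most
    [e * x] because [q x <= L * x]. *)
Lemma sublinear_diff_comp f g q : quasi_isometry q ->
  sublinear_diff f g -> sublinear_diff (f \o q) (g \o q).
Proof.
move=> qq fg e e0; have [L L0 qL] := quasi_isometry_linear_bound qq.
have eL : 0 < e / L by rewrite divr_gt0.
apply: filterS2 qL (quasi_isometry_cvgy qq (fg _ eL)) => x qx /= fgx.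
rewrite (le_trans fgx)// (le_trans (ler_wpM2l (ltW eL) qx))//.
by rewrite mulrA divfK// gt_eqF.
Qed.

End SublinearDifference.

(** * Orbits of H *)

Section Orbits.
Variable R : realType.
Implicit Types f g : qi_map R.

(** With [q] a quasi-inverse of [g], every [k] in [H] satisfies
    [[k][f] = [k o f o q][g]], and [k o f o q] is in [H]. *)
Lemma sublinear_diff_orbit_sub f g : sublinear_diff f g ->
  H_orbit (qi_class f) `<=` H_orbit (qi_class g).
Proof.
move=> fg _ [_ [k /ratio_cvg1_sublinear kH <-] <-].
have [q [qq qg gq]] := quasi_isometry_inv (qi_funP g).
pose p := qi_comp k (qi_comp f (QIMap qq)).
exists (qi_class p); last first.
  rewrite !qi_classM; apply/qi_classP.
  apply: (@bounded_dist_comp _ (k \o f) (k \o f) (q \o g) idfun) => //.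
  - exact: (qi_funP (qi_comp k f)).
  - by case: (qi_funP (qi_comp (QIMap qq) g)).
  - exact: bounded_dist_refl.
exists p => //; apply/ratio_cvg1_sublinear.
apply: (@sublinear_diff_trans _ (f \o q)).
  exact: (sublinear_diff_comp (qi_funP (qi_comp f (QIMap qq))) kH).
apply: (@sublinear_diff_trans _ (g \o q)).
  exact: (sublinear_diff_comp qq fg).
exact: bounded_dist_sublinear.
Qed.

(** Evaluating the equality of orbits at [[f] = 1 [f]] gives [h] in [H] with
    [f] at bounded distance from [h o g]. *)
Lemma H_orbit_eqP f g :
  H_orbit (qi_class f) = H_orbit (qi_class g) <-> sublinear_diff f g.
Proof.
split=> [fg|fg]; last first.
  apply/seteqP; split; first exact: sublinear_diff_orbit_sub.
  exact/sublinear_diff_orbit_sub/sublinear_diff_sym.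
have : H_orbit (qi_class g) (qi_class f).
  rewrite -fg; exists (qi_one R); last exact: qi_mul1.
  exists (QIMap (@quasi_isometry_id R)) => //.
  apply/ratio_cvg1_sublinear.
  exact/bounded_dist_sublinear/bounded_dist_refl.
move=> [_ [h /ratio_cvg1_sublinear hH <-]].
rewrite qi_classM => /qi_classP /bounded_dist_sublinear /sublinear_diff_sym hgf.
apply: sublinear_diff_trans hgf _.
exact: (sublinear_diff_comp (qi_funP g) hH).
Qed.

End Orbits.

(** * Slopes and affine pieces *)

Section AffinePieces.
Context {R : realType}.
Implicit Types (f g : R -> R) (x : nat -> R).

Lemma mx_norm_leP (m n : nat) (D : 'M[R]_(m, n)) (e : R) : 0 <= e ->
  `|D| <= e <-> forall i j, `|D i j| <= e.
Proof.
move=> e0; rewrite /Num.norm /= mx_normrE; split=> [De i j|De].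
  apply: le_trans De.
  exact: (le_bigmax _ (fun ij : 'I_m * 'I_n => `|D ij.1 ij.2|) (i, j)).
by apply/bigmax_leP; split=> // -[i j] _; exact: De.
Qed.

Lemma partition_cover x (k : nat) (t : R) : x 0%N <= t < x k ->
  exists2 i, (i < k)%N & x i <= t < x i.+1.
Proof.
elim: k => [|k IH] /andP[xt tx].
  by move: (le_lt_trans xt tx); rewrite ltxx.
have [xkt|txk] := leP (x k) t; first by exists k; rewrite // xkt.
by have [|i ik] := IH; [rewrite xt|exists i => //; exact: ltnW].
Qed.

Lemma partition_le x (r : nat) : (forall i : 'I_r, x i < x i.+1) ->
  forall k, (k <= r)%N -> x 0%N <= x k.
Proof.
move=> xS; elim=> // k IH kr.
by rewrite (le_trans (IH (ltnW kr)))// ltW// (xS (Ordinal kr)).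
Qed.

(** The bound [e * u] at the left end and the slope bound [e] add up to
    [e * u + e * (t - u) = e * t]: passing a cell does not worsen the
    constant, however many cells there are. *)
Lemma affine_diff_le f g (u v l l' e t : R) :
    affine_on f u v l -> affine_on g u v l' ->
    `|l - l'| <= e -> `|f u - g u| <= e * u -> u <= t <= v ->
  `|f t - g t| <= e * t.
Proof.
move=> fl gl le_e fgu /[dup] /andP[ut _] utv.
rewrite (fl _ utv) (gl _ utv).
have -> : f u + l * (t - u) - (g u + l' * (t - u)) =
    (f u - g u) + (l - l') * (t - u) by lra.
have tu : `|(l - l') * (t - u)| <= e * (t - u).
  by rewrite normrM (ger0_norm (_ : 0 <= t - u)) ?ler_wpM2r ?subr_ge0.
by have := ler_normD (f u - g u) ((l - l') * (t - u)); lra.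
Qed.

Lemma affine_pieces_bound f g x (r : nat) (A B : 'rV[R]_r) (e : R) :
    (forall i : 'I_r, x i < x i.+1) ->
    (forall i : 'I_r, affine_on f (x i) (x i.+1) (A 0 i)) ->
    (forall i : 'I_r, affine_on g (x i) (x i.+1) (B 0 i)) ->
    `|A - B| <= e -> `|f (x 0%N) - g (x 0%N)| <= e * x 0%N ->
  forall t, x 0%N <= t < x r -> `|f t - g t| <= e * t.
Proof.
move=> xS fA gB ABe fg0 t xt.
have e0 : 0 <= e := le_trans (normr_ge0 _) ABe.
have {}ABe (i : 'I_r) : `|A 0 i - B 0 i| <= e.
  by have /(mx_norm_leP _ e0)/(_ 0 i) := ABe; rewrite !mxE.
have fgx k : (k <= r)%N -> `|f (x k) - g (x k)| <= e * x k.
  elim: k => // k IH kr; pose i := Ordinal kr.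
  apply: (affine_diff_le (fA i) (gB i) (ABe i) (IH (ltnW kr))).
  by rewrite lexx andbT ltW// (xS i).
have [k kr /andP[xkt tx]] := partition_cover xt; pose i := Ordinal kr.
apply: (affine_diff_le (fA i) (gB i) (ABe i) (fgx _ (ltnW kr))).
by rewrite xkt ltW.
Qed.

(** The constant [(K - 1) / (K + 1)] makes up for dividing the increment of
    [f - g], of size [u + v], by [v - u]: [K * u < v] gives
    [(K - 1) * (u + v) <= (K + 1) * (v - u)]. *)
Lemma slope_le_of_linear_bound f g (K u v l l' e : R) : 1 < K -> 0 < u ->
    0 <= e -> K * u < v -> affine_on f u v l -> affine_on g u v l' ->
    `|f u - g u| <= e * (K - 1) / (K + 1) * u ->
    `|f v - g v| <= e * (K - 1) / (K + 1) * v ->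
  `|l - l'| <= e.
Proof.
move=> K1 u0 e0 Kuv fl gl fgu fgv.
have uv : u < v by apply: lt_trans Kuv; rewrite ltr_pMl.
have vu : u <= v <= v by rewrite lexx andbT ltW.
rewrite -(@ler_pM2r _ (v - u)) ?subr_gt0//.
rewrite -{1}(@gtr0_norm _ (v - u)) ?subr_gt0// -normrM.
have -> : (l - l') * (v - u) = (f v - g v) - (f u - g u).
  by rewrite (fl _ vu) (gl _ vu); lra.
rewrite (le_trans (ler_normB _ _))// (le_trans (lerD fgv fgu))//.
have -> : e * (K - 1) / (K + 1) * v + e * (K - 1) / (K + 1) * u =
    e * ((K - 1) * (u + v)) / (K + 1) by field; lra.
rewrite ler_pdivrMr; last lra.
by rewrite -mulrA ler_wpM2l//; nra.
Qed.

End AffinePieces.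

Theorem theorem1p1 (R : realType) (M : R) (f g : R -> R)
    (hf : pl_homeo f) (hg : pl_homeo g)
    (a : nat -> R) (r : nat -> nat) (x : nat -> nat -> R)
    (A B : forall n : nat, 'rV[R]_(r n)) :
  1 <= M ->
  H_itv_orbits M (H_orbit (pl_class hf)) ->
  H_itv_orbits M (H_orbit (pl_class hg)) ->
  (forall n : nat, 0 < a n) ->
  (forall n : nat, a n < a n.+1) ->
  a n @[n --> \oo] --> +oo ->
  f (a n) / a n @[n --> \oo] --> (1 : R) ->
  g (a n) / a n @[n --> \oo] --> (1 : R) ->
  (forall n : nat, x n 0%N = a n /\ x n (r n) = a n.+1) ->
  (forall (n : nat) (i : 'I_(r n)), x n i < x n i.+1) ->
  (forall (n : nat) (i : 'I_(r n)), affine_on f (x n i) (x n i.+1) (A n 0 i)) ->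
  (forall (n : nat) (i : 'I_(r n)), affine_on g (x n i) (x n i.+1) (B n 0 i)) ->
  (`|A n - B n| @[n --> \oo] --> (0 : R) ->
     H_orbit (pl_class hf) = H_orbit (pl_class hg)) /\
  ((exists2 K1 : R, 1 < K1 &
      forall (n : nat) (i : 'I_(r n)), K1 * x n i < x n i.+1) ->
   H_orbit (pl_class hf) = H_orbit (pl_class hg) ->
   `|A n - B n| @[n --> \oo] --> (0 : R)).
Proof.
move=> _ _ _ a0 aS ay fa1 ga1 xE xS fA gB.
have apos : \forall n \near \oo, 0 < a n by near=> n; exact: a0.
split=> [AB0|[K K1 xK] /H_orbit_eqP fg].
- apply/H_orbit_eqP => e e0.
  have e2 : 0 < e / 2 by rewrite divr_gt0.
  have [N _ HN] : \forall n \near \oo,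
      `|A n - B n| <= e /\ `|f (a n) - g (a n)| <= e * a n.
    have /(ratio_cvg1P _ _ apos)/(_ _ e2) fa := fa1.
    have /(ratio_cvg1P _ _ apos)/(_ _ e2) ga := ga1.
    have /cvgr0Pnorm_le/(_ _ e0) AB := AB0.
    near=> n; split; first by near: n; apply: filterS AB => k; rewrite normr_id.
    have fan : `|f (a n) - a n| <= e / 2 * a n by near: n; exact: fa.
    have gan : `|g (a n) - a n| <= e / 2 * a n by near: n; exact: ga.
    by have := ler_distD (a n) (f (a n)) (g (a n)); rewrite (distrC (a n)); lra.
  near=> t.
  have aNt : a N <= t by [].
  have [m _ /(_ (N + m)%N (leq_addl _ _)) tam] :
    \forall n \near \oo, t < a n by exact: (cvgry_gt ay).
  have [|i _ /andP[ait tai]] := @partition_cover _ (fun k => a (N + k)%N) m t.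
    by rewrite addn0 aNt tam.
  have [ABe fge] := HN (N + i)%N (leq_addr _ _).
  have [x0 xr] := xE (N + i)%N.
  apply: (affine_pieces_bound (xS (N + i)%N) (fA (N + i)%N) (gB (N + i)%N) ABe).
    by rewrite x0.
  by rewrite x0 xr ait -addnS.
- apply/cvgr0Pnorm_le => e e0.
  have c0 : 0 < e * (K - 1) / (K + 1) by rewrite divr_gt0 ?mulr_gt0//; lra.
  have [T [_ HT]] := fg _ c0.
  near=> n; rewrite normr_id; apply/mx_norm_leP; first exact: ltW.
  move=> i0 i; rewrite ord1 !mxE.
  have Tx k : (k <= r n)%N -> T < x n k.
    move=> /(partition_le (xS n)); apply: lt_le_trans.
    by rewrite (xE n).1; near: n; exact: (cvgry_gt ay).
  have xi0 : 0 < x n i.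
    rewrite (lt_le_trans (a0 n))// -(xE n).1.
    exact: (partition_le (xS n) (ltnW (ltn_ord i))).
  apply: (slope_le_of_linear_bound K1 xi0 (ltW e0) (xK n i) (fA n i) (gB n i)).
    exact: (HT _ (Tx _ (ltnW (ltn_ord i)))).
  exact: (HT _ (Tx _ (ltn_ord i))).
Unshelve. all: by end_near. Qed.
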